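(* Consider the It\^o system $$dx(t)=[A(t)x(t)+B(t)u(t)]dt+[\bar A(t)x(t)+\bar B(t)u(t)]dw(t),\quad x(t_0)=x_0,$$ with state $x\in\mathbb R^n$, control $u\in\mathbb R^m$, and the cost $$J(t_0,x_0;u)=E\int_{t_0}^T[x'(t)Q(t)x(t)+u'(t)R(t)u(t)]dt+E\,x'(T)Hx(T),$$ with $Q(t),R(t),H$ symmetric. Let Problem 2 be: for any $(t_0,x_0)$, find an $\mathcal F_t$-adapted controller $u\in\mathcal U[t_0,T]$ minimizing $J(t_0,x_0;u)$ subject to the system. Assume convexity: $J(t_0,0;u)\ge 0$ for all $u\in\mathcal U[t_0,T]$. Suppose there exists a symmetric matrix $P_1(T)\in\mathbb R^{n\times n}$ such that, with $P(t)$, $P_1(t)$ and the other notation as in the context: (a) the following hold on $[t_0,T]$: (i) $L'(t)=L'(t)[I-P_1(t)\bar F_0(t)]^{\dagger}[I-P_1(t)\bar F_0(t)]$ for $L=B$, $\bar A$, $\bar B$; (ii) $[\Upsilon_0(t)+\bar B'(t)P_1(t)\bar B(t)]^{\dagger}L'(t)=\{I-\Upsilon_0^{\dagger}(t)\bar B'(t)[I-P_1(t)\bar F_0(t)]^{\dagger}P_1(t)\bar B(t)\}\Upsilon_0^{\dagger}(t)L'(t)$ for $L=B$, $\bar B$; (iii) $0=\bar B_0'(t)[I-P_1(t)\bar F_0(t)]^{\dagger}P_1(t)\bar B_0(t)$; (b) the changed cost $$\bar J(t_0,x_0;u)=J(t_0,x_0;u)+E\{x'(T)P_1(T)x(T)\}$$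 is regular (in the sense defined in the context); (c) $P_1(T)x(T)=0$ is achieved with the controller minimizing $\bar J$ (i.e. for every $(t_0,x_0)$ there is a controller in $\mathcal U[t_0,T]$ minimizing $\bar J(t_0,x_0;\cdot)$ whose state satisfies $P_1(T)x(T)=0$). Then Problem 2 is solvable, i.e. a minimizing controller exists for every $(t_0,x_0)$.
   Context: $'$ denotes transpose, $M^{\dagger}$ the Moore-Penrose inverse. $w$ is a standard one-dimensional Brownian motion, $\mathcal F_t=\sigma\{w(s):t_0\le s\le t\}$; $A(t),B(t),\bar A(t),\bar B(t)$ are deterministic matrices of compatible dimensions. Admissible controls: $\mathcal U[t_0,T]=\{u: u(t)\ \mathcal F_t\text{-adapted},\ E\int_{t_0}^T\|u(t)\|^2dt<\infty\}$. $P(t)$ is the symmetric solution of $$0=\dot P+A'P+PA+\bar A'P\bar A+Q-\Gamma_0'\Upsilon_0^{\dagger}\Gamma_0,\quad P(T)=H,$$ $$\Upsilon_0=R+\bar B'P\bar B,\qquad \Gamma_0=B'P+\bar B'P\bar A .$$ Let $\mathrm{rank}\,\Upsilon_0(t)=m_0<m$. $T_0(t)$ is an (invertible) elementary row transformation matrix with $T_0[I-\Upsilon_0^{\dagger}\Upsilon_0]=\begin{bmatrix}0\\ \Upsilon_{T_0}\end{bmatrix}$, $\Upsilon_{T_0}(t)\in\mathbb R^{(m-m_0)\times m}$ of full row rank. $\bar B_0(t)\in\mathbb R^{n\times(m-m_0)}$ is the block of last $m-m_0$ columns in $$\begin{bmatrix}\ast&\bar B_0\end{bmatrix}=\bar B[I-\Upsilon_0^{\dagger}\Upsilon_0]T_0^{-1}.$$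 Furthermore $$A_0=A-B\Upsilon_0^{\dagger}\Gamma_0,\quad \bar A_0=\bar A-\bar B\Upsilon_0^{\dagger}\Gamma_0,\quad D_0=-B\Upsilon_0^{\dagger}B',\quad \bar D_0=-\bar B\Upsilon_0^{\dagger}B',$$ $$F_0=-B\Upsilon_0^{\dagger}\bar B',\quad \bar F_0=-\bar B\Upsilon_0^{\dagger}\bar B'.$$ Given the terminal value $P_1(T)$, $P_1(t)$ is the symmetric solution of $$0=\dot P_1+P_1A_0+A_0'P_1+P_1D_0P_1+[\bar A_0'+P_1F_0][I-P_1\bar F_0]^{\dagger}P_1[\bar A_0+\bar D_0P_1].$$ Regularity: the changed cost $\bar J$ is called regular if the solution $\bar P(t)$ of $$0=\dot{\bar P}+A'\bar P+\bar PA+\bar A'\bar P\bar A+Q-\bar\Gamma'\bar\Upsilon^{\dagger}\bar\Gamma,\quad \bar P(T)=H+P_1(T),$$ $$\bar\Upsilon=R+\bar B'\bar P\bar B,\qquad \bar\Gamma=B'\bar P+\bar B'\bar P\bar A,$$ satisfies $\mathrm{Range}[\bar\Gamma(t)]\subseteq\mathrm{Range}[\bar\Upsilon(t)]$, equivalently $[I-\bar\Upsilon(t)\bar\Upsilon^{\dagger}(t)]\bar\Gamma(t)=0$, on $[t_0,T]$. *)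

(* Defs.v *)
From HB Require Import structures.
From mathcomp Require Import all_boot all_order all_algebra.
From mathcomp Require Import all_classical all_reals all_analysis.
Set Implicit Arguments.
Unset Strict Implicit.
Unset Printing Implicit Defensive.
Import Order.TTheory GRing.Theory Num.Theory.
Import numFieldNormedType.Exports.
Local Open Scope classical_set_scope.
Local Open Scope ring_scope.

Section MoorePenrose.
Variable R : realType.

Definition penrose m n (M : 'M[R]_(m, n)) (X : 'M[R]_(n, m)) : Prop :=
  [/\ M *m X *m M = M,
      X *m M *m X = X,
      (M *m X)^T = M *m X &
      (X *m M)^T = X *m M].

(* [mpinv_penrose] and [penrose_unique] below show that the four equations
   determine exactly one matrix, so the default value 0 is never used. *)
Definition mpinv m n (M : 'M[R]_(m, n)) : 'M[R]_(n, m) :=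
  xget 0 [set X | penrose M X].

Lemma penrose_unique m n (M : 'M[R]_(m, n)) (X Y : 'M[R]_(n, m)) :
  penrose M X -> penrose M Y -> X = Y.
Proof.
move=> [X1 X2 X3 X4] [Y1 Y2 Y3 Y4].
have MXY : M *m X = M *m Y.
  have E : M *m X = (M *m Y) *m (M *m X) by rewrite !mulmxA Y1.
  by rewrite -[LHS]X3 [in LHS]E trmx_mul X3 Y3 mulmxA X1.
have XYM : X *m M = Y *m M.
  have E : X *m M = (X *m M) *m (Y *m M) by rewrite -!mulmxA (mulmxA M) Y1.
  by rewrite -[LHS]X4 [in LHS]E trmx_mul X4 Y4 -!mulmxA (mulmxA M) X1.
by rewrite -X2 XYM -mulmxA MXY mulmxA Y2.
Qed.

Lemma gram_unitmx m r (C : 'M[R]_(m, r)) : row_full C -> C^T *m C \in unitmx.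
Proof.
move=> Cfull; rewrite -row_free_unit -kermx_eq0.
apply/eqP/row_matrixP => i; rewrite row0.
set v := row i _.
have vG : v *m (C^T *m C) = 0 by apply/sub_kermxP; exact: row_sub.
have Cv0 : v *m C^T = 0.
  have q0 : \sum_j (v *m C^T) 0 j ^+ 2 = 0.
    have : ((v *m C^T) *m (v *m C^T)^T) 0 0 = 0.
      by rewrite trmx_mul trmxK mulmxA -(mulmxA v) vG mul0mx mxE.
    rewrite mxE => q0; rewrite -[RHS]q0; apply: eq_bigr => j _.
    by rewrite [X in _ = _ * X]mxE expr2.
  apply/matrixP => a j; rewrite ord1 [RHS]mxE.
  have /psumr_eq0P : forall k, true -> 0 <= (v *m C^T) 0 k ^+ 2.
    by move=> ? _; exact: sqr_ge0.
  by move=> /(_ q0 j isT)/eqP; rewrite sqrf_eq0 => /eqP.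
have: row_free C^T by rewrite /row_free mxrank_tr.
by move=> /row_free_inj/(_ v 0); apply; rewrite mul0mx.
Qed.

Lemma penrose_exists m n (M : 'M[R]_(m, n)) : exists X, penrose M X.
Proof.
have [r [C [F [<- fC fF]]]] : exists r (C : 'M[R]_(m, r)) (F : 'M[R]_(r, n)),
    [/\ C *m F = M, row_full C & row_free F].
  exists (\rank M), (col_base M), (row_base M).
  by rewrite mulmx_base col_base_full row_base_free.
have uC : C^T *m C \in unitmx by exact: gram_unitmx.
have uF : F *m F^T \in unitmx.
  rewrite -{1}[F]trmxK; apply: gram_unitmx.
  by rewrite /row_full mxrank_tr.
pose a := invmx (F *m F^T); pose b := invmx (C^T *m C).
have aT : a^T = a by rewrite trmx_inv trmx_mul trmxK.
have bT : b^T = b by rewrite trmx_inv trmx_mul trmxK.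
pose X := F^T *m a *m b *m C^T.
have MX : C *m F *m X = C *m b *m C^T.
  rewrite /X !mulmxA -(mulmxA C F) -(mulmxA C (F *m F^T)) mulmxV //.
  by rewrite mulmx1.
have XM : X *m (C *m F) = F^T *m a *m F.
  by rewrite /X -!mulmxA (mulmxA C^T) (mulmxA b) mulVmx // mul1mx.
exists X; split.
- by rewrite MX -!mulmxA (mulmxA C^T) (mulmxA b) mulVmx // mul1mx.
- by rewrite XM /X -!mulmxA (mulmxA F) (mulmxA a) mulVmx // mul1mx.
- by rewrite MX !trmx_mul trmxK bT mulmxA.
- by rewrite XM !trmx_mul trmxK aT mulmxA.
Qed.

Lemma mpinv_penrose m n (M : 'M[R]_(m, n)) : penrose M (mpinv M).
Proof. by case: (penrose_exists M) => X; exact: xgetI. Qed.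

End MoorePenrose.

Section Brownian.
Context {R : realType} {d : measure_display} {Omega : measurableType d}.
Variable Pr : probability Omega R.
Implicit Types (w : R -> Omega -> R) (F : R -> set (set Omega)).

(* Independence of increments: for every finite increasing sequence of times
   the increments are mutually independent.  The product rule for all choices
   of Borel sets covers subfamilies, by taking some of the sets to be [setT].
   [normal_prob a s] is the Gaussian law with mean a and standard deviation s. *)
Definition brownian_motion w : Prop :=
  [/\ (forall t, 0 <= t -> measurable_fun setT (w t)),
      {ae Pr, forall o, w 0 o = 0},
      (forall (k : nat) (s : nat -> R) (E : nat -> set R),
         0 <= s 0%N -> (forall i, s i <= s i.+1) ->
         (forall i, measurable (E i)) ->
         Pr (\bigcap_(i in [set i | (i < k)%N])
               [set o | E i (w (s i.+1) o - w (s i) o)]) =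
         (\prod_(i < k) Pr [set o | E i (w (s i.+1) o - w (s i) o)%R])%E),
      (forall s t, 0 <= s -> s < t -> forall E : set R, measurable E ->
         Pr [set o | E (w t o - w s o)] =
         normal_prob 0 (Num.sqrt (t - s)) E) &
      {ae Pr, forall o, {within `[0, +oo[, continuous (fun t => w t o)}}].

Definition brownian_filtration w (t0 : R) : R -> set (set Omega) :=
  fun t => <<s \bigcup_(s in `[t0, t])
                 preimage_set_system setT (w s) measurable >>.

Definition measurable_wrt (G : set (set Omega)) (f : Omega -> R) : Prop :=
  forall E : set R, measurable E -> G (f @^-1` E).

Definition jointly_measurable (a b : R) (f : R -> Omega -> R) : Prop :=
  measurable_fun (`[a, b] `*` setT)
    (fun p : measurableTypeR R * Omega => f p.1 p.2).

(* The process sum_k c_k 1_{]a_k, b_k]}; the intervals may overlap, which gives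
   the same class as disjoint intervals. *)
Record simple_process := SimpleProcess {
  sp_size : nat;
  sp_lo : 'I_sp_size -> R;
  sp_hi : 'I_sp_size -> R;
  sp_coef : 'I_sp_size -> Omega -> R }.

Definition sp_adapted F (a b : R) (phi : simple_process) : Prop :=
  forall k : 'I_(sp_size phi),
    [/\ a <= sp_lo k, sp_lo k <= sp_hi k, sp_hi k <= b,
        measurable_wrt (F (sp_lo k)) (sp_coef k) &
        exists M : R, forall o, `|sp_coef k o| <= M].

Definition sp_val (phi : simple_process) (t : R) (o : Omega) : R :=
  \sum_(k < sp_size phi) sp_coef k o * \1_(`]sp_lo k, sp_hi k]) t.

Definition sp_int w (phi : simple_process) (o : Omega) : R :=
  \sum_(k < sp_size phi) sp_coef k o * (w (sp_hi k) o - w (sp_lo k) o).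

(* [I] is (a version of) the Ito integral of [f] over [a, b] with respect to
   [w]: the mean-square limit of the elementary integrals along simple adapted
   processes converging to [f] in L^2([a, b] x Omega). *)
Definition is_ito_integral w F (a b : R) (f : R -> Omega -> R)
    (I : Omega -> R) : Prop :=
  [/\ jointly_measurable a b f,
      measurable_fun setT I &
      exists phi : nat -> simple_process,
        [/\ forall k, sp_adapted F a b (phi k),
            (fun k => \int[Pr]_o \int[lebesgue_measure]_(t in `[a, b])
               ((f t o - sp_val (phi k) t o) ^+ 2)%:E)%E @ \oo --> 0%E &
            (fun k => \int[Pr]_o
               ((I o - sp_int w (phi k) o) ^+ 2)%:E)%E @ \oo --> 0%E]].

End Brownian.

Section LinearQuadratic.
Variables (R : realType) (n m : nat).
Local Notation mu := (@lebesgue_measure R).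

(* Data of dx = (A x + B u) dt + (Abar x + Bbar u) dw with running weights
   Q, W (the control weight, usually called R) and terminal weight H. *)
Record lq_data := LQData {
  lqA : R -> 'M[R]_n;
  lqB : R -> 'M[R]_(n, m);
  lqAbar : R -> 'M[R]_n;
  lqBbar : R -> 'M[R]_(n, m);
  lqQ : R -> 'M[R]_n;
  lqW : R -> 'M[R]_m;
  lqH : 'M[R]_n }.

Definition add_terminal (S : lq_data) (K : 'M[R]_n) : lq_data :=
  LQData (lqA S) (lqB S) (lqAbar S) (lqBbar S) (lqQ S) (lqW S) (lqH S + K).

Definition bounded_measurable p q (T : R) (M : R -> 'M[R]_(p, q)) : Prop :=
  forall i j, measurable_fun `[0, T] (fun t => M t i j) /\
    exists c : R, forall t, t \in `[0, T] -> `|M t i j| <= c.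

Definition lq_standing (S : lq_data) (T : R) : Prop :=
  [/\ bounded_measurable T (lqA S), bounded_measurable T (lqB S),
      bounded_measurable T (lqAbar S) & bounded_measurable T (lqBbar S)] /\
  [/\ bounded_measurable T (lqQ S), bounded_measurable T (lqW S),
      forall t, t \in `[0, T] -> (lqQ S t)^T = lqQ S t,
      forall t, t \in `[0, T] -> (lqW S t)^T = lqW S t &
      (lqH S)^T = lqH S].

(* [X] is a symmetric solution on [0, T] of 0 = dX/dt + G(t, X), X(T) = XT.
   Since coefficients are only measurable and G may involve pseudo-inverses,
   the equation is understood in Caratheodory's sense, i.e. in integrated form;
   where s |-> G(s, X(s)) is continuous this is a classical solution. *)
Definition symmetric_backward_solution (G : R -> 'M[R]_n -> 'M[R]_n)
    (T : R) (XT : 'M[R]_n) (X : R -> 'M[R]_n) : Prop :=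
  [/\ forall t, t \in `[0, T] -> (X t)^T = X t,
      X T = XT &
      forall i j,
        mu.-integrable `[0, T] (fun s => (G s (X s) i j)%:E) /\
        forall t, t \in `[0, T] ->
          X t i j = XT i j + \int[mu]_(s in `[t, T]) G s (X s) i j].

Definition lqUpsilon (S : lq_data) (t : R) (P : 'M[R]_n) : 'M[R]_m :=
  lqW S t + (lqBbar S t)^T *m P *m lqBbar S t.

Definition lqGamma (S : lq_data) (t : R) (P : 'M[R]_n) : 'M[R]_(m, n) :=
  (lqB S t)^T *m P + (lqBbar S t)^T *m P *m lqAbar S t.

Definition riccati_rhs (S : lq_data) (t : R) (P : 'M[R]_n) : 'M[R]_n :=
  (lqA S t)^T *m P + P *m lqA S t + (lqAbar S t)^T *m P *m lqAbar S t
  + lqQ S t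
  - (lqGamma S t P)^T *m mpinv (lqUpsilon S t P) *m lqGamma S t P.

Definition riccati_solution (S : lq_data) (T : R) (P : R -> 'M[R]_n) : Prop :=
  symmetric_backward_solution (riccati_rhs S) T (lqH S) P.

(* Row spaces of transposes are column spaces, so the last condition reads
   Range (Gamma t) is contained in Range (Upsilon t). *)
Definition regular (S : lq_data) (T : R) : Prop :=
  exists2 P : R -> 'M[R]_n, riccati_solution S T P &
    forall t, t \in `[0, T] ->
      ((lqGamma S t (P t))^T <= (lqUpsilon S t (P t))^T)%MS.

Section SecondRiccati.
Variables (S : lq_data) (P : R -> 'M[R]_n).
Let Ui t := mpinv (lqUpsilon S t (P t)).

Definition A0 t := lqA S t - lqB S t *m Ui t *m lqGamma S t (P t).
Definition Abar0 t := lqAbar S t - lqBbar S t *m Ui t *m lqGamma S t (P t).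
Definition D0 t := - (lqB S t *m Ui t *m (lqB S t)^T).
Definition Dbar0 t := - (lqBbar S t *m Ui t *m (lqB S t)^T).
Definition F0 t := - (lqB S t *m Ui t *m (lqBbar S t)^T).
Definition Fbar0 t := - (lqBbar S t *m Ui t *m (lqBbar S t)^T).

Definition riccati1_rhs (t : R) (P1 : 'M[R]_n) : 'M[R]_n :=
  P1 *m A0 t + (A0 t)^T *m P1 + P1 *m D0 t *m P1
  + ((Abar0 t)^T + P1 *m F0 t) *m mpinv (1%:M - P1 *m Fbar0 t)
    *m P1 *m (Abar0 t + Dbar0 t *m P1).

Definition riccati1_solution (T : R) (P1T : 'M[R]_n) (P1 : R -> 'M[R]_n) :
    Prop :=
  symmetric_backward_solution riccati1_rhs T P1T P1.

End SecondRiccati.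

Lemma tail_ord_subproof m0 (j : 'I_(m - m0)) : (m0 + j < m)%N.
Proof. by rewrite -ltn_subRL. Qed.

(* The j-th of the last m - m0 indices among 0, ..., m - 1. *)
Definition tail_ord m0 (j : 'I_(m - m0)) : 'I_m :=
  Ordinal (tail_ord_subproof j).

Definition kernel_projector (S : lq_data) (t : R) (P : 'M[R]_n) : 'M[R]_m :=
  1%:M - mpinv (lqUpsilon S t P) *m lqUpsilon S t P.

(* T0 is invertible and T0 (I - Upsilon^+ Upsilon) = [0; UpsT0], where UpsT0
   consists of the last m - m0 rows and has full row rank. *)
Definition row_reduces m0 (S : lq_data) (t : R) (P : 'M[R]_n) (T0 : 'M[R]_m) :
    Prop :=
  [/\ T0 \in unitmx,
      forall i : 'I_m, (i < m0)%N -> row i (T0 *m kernel_projector S t P) = 0 &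
      row_free (rowsub (@tail_ord m0) (T0 *m kernel_projector S t P))].

Definition Bbar0 m0 (S : lq_data) (t : R) (P : 'M[R]_n) (T0 : 'M[R]_m) :
    'M[R]_(n, m - m0) :=
  colsub (@tail_ord m0) (lqBbar S t *m kernel_projector S t P *m invmx T0).

Context {d : measure_display} {Omega : measurableType d}.
Variables (Pr : probability Omega R) (w : R -> Omega -> R).

Definition quad p (M : 'M[R]_p) (v : 'cV[R]_p) : R := (v^T *m M *m v) 0 0.

Definition admissible (t0 T : R) (u : R -> Omega -> 'cV[R]_m) : Prop :=
  [/\ forall i, jointly_measurable t0 T (fun t o => u t o i 0),
      forall t i, t \in `[t0, T] ->
        measurable_wrt (brownian_filtration w t0 t) (fun o => u t o i 0) &
      (\int[Pr]_o \int[mu]_(t in `[t0, T]) (quad 1%:M (u t o))%:E < +oo)%E].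

(* [x] is a square-integrable continuous solution of the state equation for the
   control [u] with x(t0) = x0.  It is adapted up to null sets because the right
   hand side of the integral equation is. *)
Definition is_state (S : lq_data) (t0 T : R) (x0 : 'cV[R]_n)
    (u : R -> Omega -> 'cV[R]_m) (x : R -> Omega -> 'cV[R]_n) : Prop :=
  [/\ forall i, jointly_measurable t0 T (fun t o => x t o i 0),
      {ae Pr, forall o i, {within `[t0, T], continuous (fun t => x t o i 0)}},
      (\int[Pr]_o \int[mu]_(t in `[t0, T]) (quad 1%:M (x t o))%:E < +oo)%E,
      forall t, t \in `[t0, T] -> (\int[Pr]_o (quad 1%:M (x t o))%:E < +oo)%E &
      forall t i, t \in `[t0, T] ->
        exists2 I : Omega -> R,
          is_ito_integral Pr w (brownian_filtration w t0) t0 t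
            (fun s o => (lqAbar S s *m x s o + lqBbar S s *m u s o) i 0) I &
          {ae Pr, forall o, x t o i 0 = x0 i 0
             + \int[mu]_(s in `[t0, t]) (lqA S s *m x s o + lqB S s *m u s o) i 0
             + I o}].

Definition cost (S : lq_data) (t0 T : R) (u : R -> Omega -> 'cV[R]_m)
    (x : R -> Omega -> 'cV[R]_n) : \bar R :=
  (\int[Pr]_o \int[mu]_(t in `[t0, T])
     (quad (lqQ S t) (x t o) + quad (lqW S t) (u t o))%:E
   + \int[Pr]_o (quad (lqH S) (x T o))%:E)%E.

Definition changed_cost (S : lq_data) (K : 'M[R]_n) (t0 T : R)
    (u : R -> Omega -> 'cV[R]_m) (x : R -> Omega -> 'cV[R]_n) : \bar R :=
  (cost S t0 T u x + \int[Pr]_o (quad K (x T o))%:E)%E.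

(* The state of a control is unique up to indistinguishability, so for the two
   costs above [J u x] depends on the control [u] only. *)
Definition minimizes (S : lq_data) (t0 T : R) (x0 : 'cV[R]_n)
    (J : (R -> Omega -> 'cV[R]_m) -> (R -> Omega -> 'cV[R]_n) -> \bar R)
    (u : R -> Omega -> 'cV[R]_m) (x : R -> Omega -> 'cV[R]_n) : Prop :=
  [/\ admissible t0 T u, is_state S t0 T x0 u x &
      forall v y, admissible t0 T v -> is_state S t0 T x0 v y ->
        (J u x <= J v y)%E].

(* J(t0, x0; u) is a quadratic functional of u with quadratic part J(t0, 0; u),
   so it is convex in u exactly when the latter is nonnegative. *)
Definition lq_convex (S : lq_data) (T : R) : Prop :=
  forall t0, 0 <= t0 -> t0 < T -> forall u x,
    admissible t0 T u -> is_state S t0 T 0 u x -> (0 <= cost S t0 T u x)%E.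

Definition lq_solvable (S : lq_data) (T : R) : Prop :=
  forall t0 (x0 : 'cV[R]_n), 0 <= t0 -> t0 < T ->
    exists u x, minimizes S t0 T x0 (cost S t0 T) u x.

Definition terminal_constraint_achieved (S : lq_data) (T : R) (K : 'M[R]_n) :
    Prop :=
  forall t0 (x0 : 'cV[R]_n), 0 <= t0 -> t0 < T ->
    exists u x, minimizes S t0 T x0 (changed_cost S K t0 T) u x /\
      {ae Pr, forall o, K *m x T o = 0}.

End LinearQuadratic.

(* Main.v *)
Require Import Defs.
From HB Require Import structures.
From mathcomp Require Import all_boot all_order all_algebra.
From mathcomp Require Import all_classical all_reals all_analysis.
From mathcomp Require Import measurable_realfun.
From mathcomp Require Import ring lra.

(* Let u be a controller minimizing the cost J + E x(T)'K x(T), K = P1(T), with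
   state x such that K x(T) = 0.  For a competitor v with state y, the controls
   (1 - e) u + e v have states (1 - e) x + e y, and along this segment J is a
   quadratic polynomial a + b e + c e^2 with c = J(t0, 0; v - u) >= 0, while the
   additional terminal term is e^2 E y(T)'K y(T), without linear part because K
   annihilates x(T).  Minimality at e = 0 thus forces b = 0, so that
   J(v) = a + c >= a = J(u). *)

Set Implicit Arguments.
Unset Strict Implicit.
Unset Printing Implicit Defensive.
Import Order.TTheory GRing.Theory Num.Theory.
Import numFieldNormedType.Exports.
Local Open Scope classical_set_scope.
Local Open Scope ring_scope.

(** * Square-integrable functions on a measurable set *)

Section SquareIntegrable.
Context {d} {X : measurableType d} {R : realType}.
Variables (nu : {measure set X -> \bar R}) (D : set X).
Hypothesis mD : measurable D.

Definition square_integrable (f : X -> R) : Prop :=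
  measurable_fun D f /\ nu.-integrable D (EFin \o (fun x => f x ^+ 2)).

Lemma measurable_fun_sqr (f : X -> R) :
  measurable_fun D f -> measurable_fun D (fun x => f x ^+ 2).
Proof. by move=> mf; exact: measurable_funX. Qed.

Lemma square_integrableP (f : X -> R) : measurable_fun D f ->
  (\int[nu]_(x in D) (f x ^+ 2)%:E < +oo)%E -> square_integrable f.
Proof.
move=> mf foo; split => //; apply/integrableP; split.
  by apply/measurable_EFinP; exact: measurable_fun_sqr.
by under eq_integral do rewrite /= ger0_norm ?sqr_ge0//.
Qed.

(** The product is dominated by the integrable function [f ^+ 2 + g ^+ 2], because
    [(|f| - |g|) ^+ 2] is nonnegative. *)
Lemma square_integrableM (f g : X -> R) :
  square_integrable f -> square_integrable g ->
  nu.-integrable D (EFin \o (fun x => f x * g x)).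
Proof.
move=> [mf f2] [mg g2].
apply: (le_integrable mD _ _ (integrableD mD f2 g2)).
  by apply/measurable_EFinP; exact: measurable_funM.
move=> x _ /=; rewrite lee_fin normrM [leRHS]ger0_norm ?addr_ge0 ?sqr_ge0//.
rewrite -(real_normK (num_real (f x))) -(real_normK (num_real (g x))).
have := sqr_ge0 (`|f x| - `|g x|); have := sqr_ge0 `|f x|.
by have := sqr_ge0 `|g x|; nra.
Qed.

Lemma square_integrable_bndM (f g : X -> R) (c : R) :
  measurable_fun D g -> (forall x, D x -> `|g x| <= c) ->
  square_integrable f -> square_integrable (fun x => g x * f x).
Proof.
move=> mg gc [mf f2]; split; first exact: measurable_funM.
apply: (le_integrable mD _ _ (integrableZl mD (c ^+ 2) f2)).
  by apply/measurable_EFinP/measurable_fun_sqr; exact: measurable_funM.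
move=> x Dx /=; rewrite lee_fin ger0_norm ?sqr_ge0// ger0_norm; last first.
  by rewrite mulr_ge0 ?sqr_ge0.
rewrite exprMn.
rewrite ler_wpM2r ?sqr_ge0// -(real_normK (num_real (g x))).
by rewrite lerXn2r ?nnegrE//; [exact: le_trans (gc x Dx)|exact: gc].
Qed.

Lemma square_integrableZ (f : X -> R) (c : R) :
  square_integrable f -> square_integrable (fun x => c * f x).
Proof. by apply: (@square_integrable_bndM f (cst c) `|c|) => //. Qed.

Lemma square_integrableD (f g : X -> R) :
  square_integrable f -> square_integrable g ->
  square_integrable (fun x => f x + g x).
Proof.
move=> sf sg; split; first by apply: measurable_funD; [exact: sf.1|exact: sg.1].
have fg := square_integrableM sf sg.
have := integrableD mD (integrableD mD sf.2 sg.2) (integrableZl mD 2 fg).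
move=> fg2; apply: (eq_integrable mD _ _ _ fg2) => x _ /=; congr EFin.
by ring.
Qed.

Lemma square_integrable_sum (I : Type) (s : seq I) (f : I -> X -> R) :
  (forall i, square_integrable (f i)) ->
  square_integrable (fun x => \sum_(i <- s) f i x).
Proof.
move=> sf; elim: s => [|i s ih].
  under eq_fun do rewrite big_nil.
  split => //; under eq_fun do rewrite expr0n; exact: integrable0.
by under eq_fun do rewrite big_cons; exact: square_integrableD.
Qed.

(** On a set of finite measure the constant 1 is square-integrable, and [f] is its product with that
    constant. *)
Lemma square_integrable_integrable (f : X -> R) :
  (nu D < +oo)%E -> square_integrable f -> nu.-integrable D (EFin \o f).
Proof.
move=> Doo sf; have s1 : square_integrable (cst 1).
  apply: square_integrableP => //.
  by under eq_integral do rewrite expr1n; rewrite integral_cst// mul1e.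
have fM1 := square_integrableM sf s1.
by apply: (eq_integrable mD _ _ _ fM1) => x _ /=; rewrite mulr1.
Qed.

(** Pointwise this is the nonnegativity of [(a f - b g) ^+ 2]. Measurability alone is assumed and
    the integrals may be infinite, so the bound applies directly to the approximation errors in the
    definition of the Ito integral. *)
Lemma le_integral_sqr_lin (f g : X -> R) (a b : R) :
  measurable_fun D f -> measurable_fun D g ->
  (\int[nu]_(x in D) ((a * f x + b * g x) ^+ 2)%:E <=
   (2 * a ^+ 2)%:E * \int[nu]_(x in D) (f x ^+ 2)%:E +
   (2 * b ^+ 2)%:E * \int[nu]_(x in D) (g x ^+ 2)%:E)%E.
Proof.
move=> mf mg.
have mf2 : measurable_fun D (fun x => (f x ^+ 2)%:E).
  by apply/measurable_EFinP; exact: measurable_fun_sqr.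
have mg2 : measurable_fun D (fun x => (g x ^+ 2)%:E).
  by apply/measurable_EFinP; exact: measurable_fun_sqr.
have c0 c : (0 <= (2 * c ^+ 2)%:E :> \bar R)%E.
  by rewrite lee_fin mulr_ge0 ?sqr_ge0.
have sqr0 (h : X -> R) x : D x -> (0 <= (h x ^+ 2)%:E)%E.
  by rewrite lee_fin sqr_ge0.
rewrite -(ge0_integralZl nu mD mf2 (sqr0 f) (c0 a)).
rewrite -(ge0_integralZl nu mD mg2 (sqr0 g) (c0 b)).
have mZ c h : measurable_fun D h -> measurable_fun D (fun x => c%:E * h x)%E.
  by move=> mh; exact: measurable_funeM.
rewrite -ge0_integralD//; [|by move=> x Dx; rewrite mule_ge0 ?sqr0|
  exact: mZ|by move=> x Dx; rewrite mule_ge0 ?sqr0|exact: mZ].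
apply: ge0_le_integral => //.
- by move=> x _; rewrite lee_fin sqr_ge0.
- apply/measurable_EFinP/measurable_fun_sqr.
  by apply: measurable_funD; exact: measurable_funM.
- by apply: emeasurable_funD; exact: emeasurable_funM.
- move=> x _; rewrite -!EFinM -EFinD lee_fin.
  have := sqr_ge0 (a * f x - b * g x); nra.
Qed.

End SquareIntegrable.

(** * Quadratic forms along a segment *)

Section QuadraticForms.
Context {R : realType}.

Lemma quadE p (M : 'M[R]_p) (v : 'cV[R]_p) :
  quad M v = \sum_i v i 0 * \sum_j M i j * v j 0.
Proof.
rewrite /quad -mulmxA mxE; apply: eq_bigr => i _.
by rewrite !mxE.
Qed.

Lemma quad1E p (v : 'cV[R]_p) : quad 1%:M v = \sum_i v i 0 ^+ 2.
Proof. by rewrite /quad mulmx1 mxE; apply: eq_bigr => i _; rewrite mxE expr2. Qed.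

Lemma quad1_ge0 p (v : 'cV[R]_p) : 0 <= quad 1%:M v.
Proof. by rewrite quad1E sumr_ge0// => i _; exact: sqr_ge0. Qed.

Lemma trmx_lin p (v y : 'cV[R]_p) (a b : R) :
  (a *: v + b *: y)^T = a *: v^T + b *: y^T.
Proof. by rewrite raddfD/= !linearZ. Qed.

(** By symmetry [v] is annihilated by [M] from both sides, so both cross terms vanish along with the
    term in [v] alone. *)
Lemma quad_ker p (M : 'M[R]_p) (v y : 'cV[R]_p) (e : R) :
  M^T = M -> M *m v = 0 -> quad M ((1 - e) *: v + e *: y) = e ^+ 2 * quad M y.
Proof.
move=> sM Mv; have vM : v^T *m M = 0 by rewrite -sM -trmx_mul Mv trmx0.
rewrite /quad trmx_lin !mulmxDl -!scalemxAl vM !mulmxDr.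
rewrite -!scalemxAr -!mulmxA Mv !(mul0mx, mulmx0, scaler0, add0r).
by rewrite scalerA !mxE expr2.
Qed.

(* The cross term of the polarization is read off at e = 1. *)
Lemma quad_segment p (M : 'M[R]_p) (v y : 'cV[R]_p) (e : R) :
  quad M ((1 - e) *: v + e *: y) =
  quad M v + e * (quad M y - quad M v - quad M ((-1) *: v + 1 *: y))
  + e ^+ 2 * quad M ((-1) *: v + 1 *: y).
Proof.
rewrite /quad !trmx_lin !mulmxDl -!scalemxAl !mulmxDr -!scalemxAr !mxE.
by ring.
Qed.

End QuadraticForms.

(** * Integrals of quadratic forms in square-integrable vectors *)

Section IntegrableForms.
Context {d} {X : measurableType d} {R : realType}.
Variables (nu : {measure set X -> \bar R}) (D : set X).
Hypothesis mD : measurable D.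

Definition bounded_measurable_on p q (M : X -> 'M[R]_(p, q)) : Prop :=
  forall i j, measurable_fun D (fun x => M x i j) /\
    exists c : R, forall x, D x -> `|M x i j| <= c.

Definition square_integrable_vec p (v : X -> 'cV[R]_p) : Prop :=
  forall i, square_integrable nu D (fun x => v x i 0).

Lemma square_integrable_vec_lin p (v y : X -> 'cV[R]_p) (a b : R) :
  square_integrable_vec v -> square_integrable_vec y ->
  square_integrable_vec (fun x => a *: v x + b *: y x).
Proof.
move=> sv sy i; under eq_fun do rewrite !mxE.
by apply: square_integrableD => //; exact: square_integrableZ.
Qed.

Lemma square_integrable_mulmx p q (M : X -> 'M[R]_(p, q)) (v : X -> 'cV[R]_q) :
  bounded_measurable_on M -> square_integrable_vec v ->
  square_integrable_vec (fun x => M x *m v x).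
Proof.
move=> bM sv i; under eq_fun do rewrite mxE.
apply: square_integrable_sum => // j; have [mM [c cM]] := bM i j.
exact: square_integrable_bndM cM _.
Qed.

Lemma integrable_quad p (M : X -> 'M[R]_p) (v : X -> 'cV[R]_p) :
  bounded_measurable_on M -> square_integrable_vec v ->
  nu.-integrable D (EFin \o (fun x => quad (M x) (v x))).
Proof.
move=> bM sv.
rewrite (_ : _ \o _ = fun x => (\sum_i (v x i 0 * (M x *m v x) i 0)%:E)%E).
  apply: integrable_sum => // i _; apply: square_integrableM => //.
  exact: square_integrable_mulmx.
apply/funext => x /=; rewrite quadE sumEFin; congr EFin.
by apply: eq_bigr => i _; rewrite mxE.
Qed.

Lemma bounded_measurable_cst p q (M : 'M[R]_(p, q)) :
  bounded_measurable_on (cst M).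
Proof. by move=> i j; split=> //; exists `|M i j|. Qed.

Lemma integrable_quad_cst p (K : 'M[R]_p) (v : X -> 'cV[R]_p) :
  square_integrable_vec v -> nu.-integrable D (EFin \o (fun x => quad K (v x))).
Proof. exact: (integrable_quad (bounded_measurable_cst K)). Qed.

(** Translates the finite-energy conditions of [admissible] and [is_state] into a coordinatewise
    form that is stable under linear operations. *)
Lemma square_integrable_vecP p (v : X -> 'cV[R]_p) :
  (forall i, measurable_fun D (fun x => v x i 0)) ->
  (\int[nu]_(x in D) (quad 1%:M (v x))%:E < +oo)%E <-> square_integrable_vec v.
Proof.
move=> mv; split=> [voo i|sv].
  apply: square_integrableP => //; apply: le_lt_trans voo.
  apply: ge0_le_integral => //.
  - by move=> x _; rewrite lee_fin sqr_ge0.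
  - exact/measurable_EFinP/measurable_fun_sqr.
  - apply/measurable_EFinP; under eq_fun do rewrite quad1E.
    by apply: measurable_sum => j; exact: measurable_fun_sqr.
  - move=> x _; rewrite lee_fin quad1E (bigD1 i)//= lerDl sumr_ge0// => j _.
    exact: sqr_ge0.
have /integrableP[_] := integrable_quad_cst 1%:M sv.
by under eq_integral do rewrite /= ger0_norm ?quad1_ge0//.
Qed.

Lemma integrable_EFinE (f : X -> R) : nu.-integrable D (EFin \o f) ->
  (\int[nu]_(x in D) (f x)%:E)%E = (\int[nu]_(x in D) f x)%:E.
Proof. by move=> /(integrable_fin_num mD) ?; rewrite /Rintegral fineK. Qed.

Lemma Rintegral_lin (f g : X -> R) (a b : R) :
  nu.-integrable D (EFin \o f) -> nu.-integrable D (EFin \o g) ->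
  \int[nu]_(x in D) (a * f x + b * g x) =
  a * \int[nu]_(x in D) f x + b * \int[nu]_(x in D) g x.
Proof.
move=> f1 g1; rewrite RintegralD// ?RintegralZl//.
- exact: (integrableZl mD a f1).
- exact: (integrableZl mD b g1).
Qed.

Lemma integrable_lin (f g : X -> R) (a b : R) :
  nu.-integrable D (EFin \o f) -> nu.-integrable D (EFin \o g) ->
  nu.-integrable D (EFin \o (fun x => a * f x + b * g x)).
Proof.
move=> f1 g1.
exact: (integrableD mD (integrableZl mD a f1) (integrableZl mD b g1)).
Qed.

Lemma Rintegral_segment (f g h : X -> R) (e : R) :
  nu.-integrable D (EFin \o f) -> nu.-integrable D (EFin \o g) ->
  nu.-integrable D (EFin \o h) ->
  \int[nu]_(x in D) (f x + e * (g x - f x - h x) + e ^+ 2 * h x) =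
  \int[nu]_(x in D) f x
  + e * (\int[nu]_(x in D) g x - \int[nu]_(x in D) f x - \int[nu]_(x in D) h x)
  + e ^+ 2 * \int[nu]_(x in D) h x.
Proof.
move=> f1 g1 h1.
(* The integrand is regrouped as nested two-term combinations, so that [Rintegral_lin] applies
   twice. *)
transitivity (\int[nu]_(x in D)
   (1 * ((1 - e) * f x + e * g x) + (e ^+ 2 - e) * h x)).
  by apply: eq_Rintegral => x _; ring.
rewrite Rintegral_lin//; last exact: integrable_lin.
by rewrite Rintegral_lin//; ring.
Qed.

End IntegrableForms.

(** * Fubini and Tonelli on the strip of times and outcomes *)

Section IteratedIntegral.
Context {R : realType} {d : measure_display} {Omega : measurableType d}.
Variables (Pr : probability Omega R) (a b : R).
Local Notation mu := (@lebesgue_measure R).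
Local Notation D := ([set` `[a, b]] `*` [set: Omega] : set (measurableTypeR R * Omega)).

Lemma measurable_strip : measurable D.
Proof. exact: measurableX. Qed.

(** Extending [f] by zero outside the strip gives access to the Fubini theorems on the whole product
    space. *)
Lemma strip_sectionE (f : measurableTypeR R * Omega -> \bar R) (o : Omega) :
  (\int[mu]_(t in `[a, b]) f (t, o) = fubini_G mu (f \_ D) o)%E.
Proof.
rewrite /fubini_G [LHS]integral_mkcond; apply: eq_integral => t _.
by rewrite /patch; congr (if _ then _ else _); apply/idP/idP; rewrite !inE//= => -[].
Qed.

Lemma ge0_iterated_integral (f : measurableTypeR R * Omega -> R) :
  measurable_fun D f -> (forall p, 0 <= f p) ->
  (\int[Pr]_o \int[mu]_(t in `[a, b]) (f (t, o))%:E =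
   \int[mu \x Pr]_(p in D) (f p)%:E)%E.
Proof.
move=> mf f0; rewrite [RHS]integral_mkcond fubini_tonelli2.
- by apply: eq_integral => o _; rewrite -strip_sectionE.
- apply/(measurable_restrictT _ measurable_strip); exact/measurable_EFinP.
- by move=> p; apply: erestrict_ge0 => q _; rewrite lee_fin.
Qed.

Lemma iterated_integral (f : measurableTypeR R * Omega -> R) :
  (mu \x Pr)%E.-integrable D (EFin \o f) ->
  (\int[Pr]_o \int[mu]_(t in `[a, b]) (f (t, o))%:E =
   \int[mu \x Pr]_(p in D) (f p)%:E)%E.
Proof.
move=> /(integrable_mkcond _ measurable_strip) fi.
rewrite [RHS]integral_mkcond -(integral21_prod_meas1 fi).
by apply: eq_integral => o _; rewrite -strip_sectionE.
Qed.

(** Makes the drift integrable in time along almost every path, as needed to split the pathwise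
    integral of a linear combination. *)
Lemma ae_integrable_section (f : measurableTypeR R * Omega -> R) :
  (mu \x Pr)%E.-integrable D (EFin \o f) ->
  {ae Pr, forall o, mu.-integrable `[a, b] (EFin \o (fun t => f (t, o)))}.
Proof.
move=> /(integrable_mkcond _ measurable_strip)/ae_integrable2.
apply: filterS => o fo; apply/integrable_mkcond => //.
apply: (eq_integrable measurableT _ _ _ fo) => t _.
by rewrite /patch; congr (if _ then _ else _); apply/idP/idP; rewrite !inE//= => -[].
Qed.

Lemma strip_lty : ((mu \x Pr) D < +oo)%E.
Proof.
rewrite product_measure1E//= lebesgue_measure_itv/= probability_setT mule1.
by case: ifP => _; rewrite ?ltry// -EFinB ltry.
Qed.

End IteratedIntegral.

(** * Measurability of sections, linear combinations and the Brownian filtration *)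

Section Sections.
Context {R : realType} {d : measure_display} {Omega : measurableType d}.

Lemma measurable_strip_section (a b t : R) (f : R -> Omega -> R) :
  t \in `[a, b] -> jointly_measurable a b f -> measurable_fun [set: Omega] (f t).
Proof.
move=> tab /(measurable_restrictT _ (@measurable_strip R d Omega a b)) mf.
have := @measurable_fun_pair2 _ _ _ _ _ _ _ t mf.
rewrite (_ : (fun y => _) = f t)//; apply/funext => o; rewrite patchT//.
by rewrite inE.
Qed.

Lemma jointly_measurable_lin (a b : R) (f g : R -> Omega -> R) (p q : R) :
  jointly_measurable a b f -> jointly_measurable a b g ->
  jointly_measurable a b (fun t o => p * f t o + q * g t o).
Proof. by move=> mf mg; apply: measurable_funD; exact: measurable_funM. Qed.

Lemma measurable_wrt_lin (G : set (set Omega)) (f g : Omega -> R) (p q : R) :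
  sigma_algebra [set: Omega] G -> measurable_wrt G f -> measurable_wrt G g ->
  measurable_wrt G (fun o => p * f o + q * g o).
Proof.
move=> sG mf mg.
(* [G] is a bare family of sets. Since it is a sigma-algebra, it is exactly the family of measurable
   sets of [g_sigma_algebraType G], where the closure properties of measurable functions are
   available. *)
have mG (h : Omega -> R) : measurable_wrt G h ->
    measurable_fun [set: g_sigma_algebraType G] (h : g_sigma_algebraType G -> R).
  move=> mh _ E mE; rewrite setTI measurable_g_measurableTypeE//; exact: mh.
have mh : measurable_fun [set: g_sigma_algebraType G]
    ((fun o => p * f o + q * g o) : g_sigma_algebraType G -> R).
  by apply: measurable_funD; apply: measurable_funM => //; exact: mG.
move=> E mE; have := mh measurableT E mE.
by rewrite setTI measurable_g_measurableTypeE.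
Qed.

Lemma measurable_wrt_measurable (G : set (set Omega)) (f : Omega -> R) :
  G `<=` measurable -> measurable_wrt G f -> measurable_fun [set: Omega] f.
Proof. by move=> Gm mf _ E mE; rewrite setTI; apply/Gm/mf. Qed.

Lemma brownian_filtration_sub (w : R -> Omega -> R) (t0 t : R) :
  (forall s, t0 <= s -> measurable_fun [set: Omega] (w s)) ->
  brownian_filtration w t0 t `<=` measurable.
Proof.
move=> mw; apply: smallest_sub; first exact: sigma_algebra_measurable.
move=> A [s]; rewrite /= in_itv/= => /andP[t0s _] [B mB <-].
exact: mw.
Qed.

End Sections.

(** * Linearity of the Ito integral *)

Lemma cvge0_lin {R : realType} (u v s : nat -> \bar R) (p q : R) :
  (forall k, 0 <= s k <= p%:E * u k + q%:E * v k)%E ->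
  u @ \oo --> 0%E -> v @ \oo --> 0%E -> s @ \oo --> 0%E.
Proof.
move=> suv u0 v0; apply: (squeeze_cvge _ (cvg_cst 0%E)).
  by apply: nearW => k; exact: suv.
rewrite -[X in _ --> X](_ : p%:E * 0 + q%:E * 0 = 0)%E; last first.
  by rewrite !mule0 adde0.
by apply: cvgeD; [rewrite !mule0|exact: cvgeZl|exact: cvgeZl].
Qed.

Section ItoLinear.
Context {R : realType} {d : measure_display} {Omega : measurableType d}.
Implicit Types (phi psi : @simple_process R d Omega).

(** The two families of intervals are concatenated. Intervals of a simple process may overlap, so no
    common refinement is taken. *)
Definition sp_lin (p q : R) phi psi : @simple_process R d Omega :=
  @SimpleProcess R d Omega (sp_size phi + sp_size psi)
    (fun k => match fintype.split k with
              | inl i => sp_lo i | inr j => sp_lo j end)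
    (fun k => match fintype.split k with
              | inl i => sp_hi i | inr j => sp_hi j end)
    (fun k => match fintype.split k with
              | inl i => fun o => p * sp_coef i o
              | inr j => fun o => q * sp_coef j o end).

Lemma sp_val_lin p q phi psi t o :
  sp_val (sp_lin p q phi psi) t o = p * sp_val phi t o + q * sp_val psi t o.
Proof.
rewrite /sp_val big_split_ord/= !big_distrr/=; congr (_ + _);
  apply: eq_bigr => i _.
- by rewrite (unsplitK (inl i)) mulrA.
- by rewrite (unsplitK (inr i)) mulrA.
Qed.

Lemma sp_int_lin (w : R -> Omega -> R) p q phi psi o :
  sp_int w (sp_lin p q phi psi) o = p * sp_int w phi o + q * sp_int w psi o.
Proof.
rewrite /sp_int big_split_ord/= !big_distrr/=; congr (_ + _);
  apply: eq_bigr => i _.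
- by rewrite (unsplitK (inl i)) mulrA.
- by rewrite (unsplitK (inr i)) mulrA.
Qed.

Variables (w : R -> Omega -> R) (F : R -> set (set Omega)) (a b : R).
Hypothesis sF : forall t, sigma_algebra [set: Omega] (F t).
Hypothesis FM : forall t, F t `<=` measurable.
Hypothesis mw : forall t, a <= t -> measurable_fun [set: Omega] (w t).

Lemma sp_adapted_lin p q phi psi :
  sp_adapted F a b phi -> sp_adapted F a b psi ->
  sp_adapted F a b (sp_lin p q phi psi).
Proof.
(* Scaling is the linear combination whose second coefficient is 0. *)
have Z (c : R) t (f : Omega -> R) : measurable_wrt (F t) f ->
    measurable_wrt (F t) (fun o => c * f o).
  move=> mf; have := measurable_wrt_lin c 0 (sF t) mf mf.
  by under eq_fun do rewrite mul0r addr0.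
move=> aphi apsi k; rewrite /sp_lin/=; case: (fintype.split k) => i.
- have [? ? ? ? [M bM]] := aphi i; split => //; first exact: Z.
  by exists (`|p| * M) => o; rewrite normrM ler_wpM2l.
- have [? ? ? ? [M bM]] := apsi i; split => //; first exact: Z.
  by exists (`|q| * M) => o; rewrite normrM ler_wpM2l.
Qed.

(** Each summand is a function of the outcome times a function of time, each composed with a
    projection. *)
Lemma measurable_sp_val phi :
  sp_adapted F a b phi -> jointly_measurable a b (sp_val phi).
Proof.
move=> aphi; apply: measurable_sum => k; have [_ _ _ mk _] := aphi k.
apply: measurable_funM; apply: measurable_funTS.
- exact: (measurableT_comp (measurable_wrt_measurable (@FM _) mk)
    (@measurable_snd _ _ (measurableTypeR R) Omega)).
- have mI : measurable_fun [set: measurableTypeR R]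
      (\1_(`]sp_lo k, sp_hi k]) : measurableTypeR R -> R).
    exact: measurable_indic.
  exact: (measurableT_comp mI (@measurable_fst _ _ (measurableTypeR R) Omega)).
Qed.

Lemma measurable_sp_int phi :
  sp_adapted F a b phi -> measurable_fun [set: Omega] (sp_int w phi).
Proof.
move=> aphi; apply: measurable_sum => k; have [alo lohi _ mk _] := aphi k.
apply: measurable_funM; first exact: measurable_wrt_measurable mk.
by apply: measurable_funB; apply: mw => //; exact: le_trans lohi.
Qed.

Variable Pr : probability Omega R.
Local Notation mu := (@lebesgue_measure R).

(** The combined simple processes approximate the combined integrand. Both mean-square errors are
    bounded by [2 p ^+ 2] and [2 q ^+ 2] times the original ones, hence tend to 0. *)
Lemma is_ito_integral_lin p q (f g : R -> Omega -> R) (I J : Omega -> R) :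
  is_ito_integral Pr w F a b f I -> is_ito_integral Pr w F a b g J ->
  is_ito_integral Pr w F a b (fun t o => p * f t o + q * g t o)
    (fun o => p * I o + q * J o).
Proof.
move=> [mf mI [phi [aphi fphi Iphi]]] [mg mJ [psi [apsi gpsi Jpsi]]].
split; first exact: jointly_measurable_lin.
  by apply: measurable_funD; exact: measurable_funM.
exists (fun k => sp_lin p q (phi k) (psi k)); split.
- by move=> k; exact: sp_adapted_lin.
- apply: (cvge0_lin _ fphi gpsi) => k; apply/andP; split.
    apply: integral_ge0 => o _; apply: integral_ge0 => t _.
    by rewrite lee_fin sqr_ge0.
  (* Passing to the product measure turns the iterated error into a single integral, to which
     [le_integral_sqr_lin] applies. *)
  have sq2 (h : measurableTypeR R * Omega -> R) :
      measurable_fun ([set` `[a, b]] `*` [set: Omega]) h ->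
      (\int[Pr]_o \int[mu]_(t in `[a, b]) (h (t, o) ^+ 2)%:E =
       \int[mu \x Pr]_(p in [set` `[a, b]] `*` [set: Omega]) (h p ^+ 2)%:E)%E.
    move=> mh; apply: (@ge0_iterated_integral _ _ _ Pr a b (fun p => h p ^+ 2)).
      exact: measurable_fun_sqr.
    by move=> ?; exact: sqr_ge0.
  pose e1 (z : measurableTypeR R * Omega) := f z.1 z.2 - sp_val (phi k) z.1 z.2.
  pose e2 (z : measurableTypeR R * Omega) := g z.1 z.2 - sp_val (psi k) z.1 z.2.
  have m1 : measurable_fun ([set` `[a, b]] `*` [set: Omega]) e1.
    by apply: measurable_funB => //; exact: measurable_sp_val.
  have m2 : measurable_fun ([set` `[a, b]] `*` [set: Omega]) e2.
    by apply: measurable_funB => //; exact: measurable_sp_val.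
  have := le_integral_sqr_lin (mu \x Pr)%E (measurable_strip a b) p q m1 m2.
  rewrite -(sq2 _ m1) -(sq2 _ m2) -sq2; last first.
    by apply: measurable_funD; exact: measurable_funM.
  apply: le_trans; rewrite le_eqVlt; apply/orP; left; apply/eqP.
  apply: eq_integral => o _; apply: eq_integral => t _; congr EFin.
  by rewrite sp_val_lin /e1 /e2/=; ring.
- apply: (cvge0_lin _ Iphi Jpsi) => k; apply/andP; split.
    by apply: integral_ge0 => o _; rewrite lee_fin sqr_ge0.
  have m1 : measurable_fun setT (fun o => I o - sp_int w (phi k) o).
    by apply: measurable_funB => //; exact: measurable_sp_int.
  have m2 : measurable_fun setT (fun o => J o - sp_int w (psi k) o).
    by apply: measurable_funB => //; exact: measurable_sp_int.
  apply: le_trans (le_integral_sqr_lin Pr measurableT p q m1 m2).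
  rewrite le_eqVlt; apply/orP; left; apply/eqP.
  by apply: eq_integral => o _; congr EFin; rewrite sp_int_lin; ring.
Qed.

End ItoLinear.

Lemma ae_conj {d} {X : measurableType d} {R : realType}
    (nu : {measure set X -> \bar R}) (P Q : X -> Prop) :
  {ae nu, forall x, P x} -> {ae nu, forall x, Q x} ->
  {ae nu, forall x, P x /\ Q x}.
Proof. by apply: filterS2. Qed.

(** * Superposition of controls and states *)

Section ControlledStates.
Context {R : realType} {d : measure_display} {Omega : measurableType d}.
Variables (Pr : probability Omega R) (w : R -> Omega -> R).
Local Notation mu := (@lebesgue_measure R).
Local Notation strip a b :=
  ([set` `[a, b]] `*` [set: Omega] : set (measurableTypeR R * Omega)).

Definition process_square_integrable p (a b : R) (v : R -> Omega -> 'cV[R]_p) :=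
  square_integrable_vec (mu \x Pr)%E (strip a b) (fun z => v z.1 z.2).

Lemma process_square_integrableP p (a b : R) (v : R -> Omega -> 'cV[R]_p) :
  (forall i, jointly_measurable a b (fun t o => v t o i 0)) ->
  (\int[Pr]_o \int[mu]_(t in `[a, b]) (quad 1%:M (v t o))%:E < +oo)%E <->
  process_square_integrable a b v.
Proof.
move=> mv.
rewrite (@ge0_iterated_integral _ _ _ Pr a b
  (fun z => quad 1%:M (v z.1 z.2))); first last.
- by move=> z; exact: quad1_ge0.
- under [X in measurable_fun _ X]eq_fun do rewrite quad1E.
  by apply: measurable_sum => i; apply: measurable_fun_sqr; exact: mv.
by apply: square_integrable_vecP; [exact: measurable_strip|exact: mv].
Qed.

(** The coefficients are controlled on [[0, T]] only, which contains [[a, T]] because [a] is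
    nonnegative. *)
Lemma bounded_measurable_strip p q (T a : R) (M : R -> 'M[R]_(p, q)) :
  0 <= a -> bounded_measurable T M ->
  bounded_measurable_on (strip a T) (fun z => M z.1).
Proof.
move=> a0 bM i j; have [mM [c cM]] := bM i j; split.
  apply: (@measurable_comp _ _ _ (measurableTypeR R * Omega)%type
    (measurableTypeR R) _ `[0, T] (fun t => M t i j)) => //.
    move=> _ [[t o]/= [+ _] <-]; rewrite !in_itv/= => /andP[ta ->].
    by rewrite (le_trans a0).
  by apply: measurable_funTS; exact: measurable_fst.
exists c => -[t o]/= [+ _]; rewrite in_itv/= => /andP[ta tT].
by apply: cM; rewrite in_itv/= tT (le_trans a0).
Qed.

Lemma process_square_integrable_affine n m (T a : R) (A : R -> 'M[R]_n)
    (B : R -> 'M[R]_(n, m)) x u : 0 <= a ->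
  bounded_measurable T A -> bounded_measurable T B ->
  process_square_integrable a T x -> process_square_integrable a T u ->
  process_square_integrable a T (fun t o => A t *m x t o + B t *m u t o).
Proof.
move=> a0 bA bB sx su i; under [X in square_integrable _ _ X]eq_fun do rewrite mxE.
apply: square_integrableD; first exact: measurable_strip.
- apply: (square_integrable_mulmx _ _ sx); first exact: measurable_strip.
  exact: bounded_measurable_strip.
- apply: (square_integrable_mulmx _ _ su); first exact: measurable_strip.
  exact: bounded_measurable_strip.
Qed.

Lemma admissible_lin m (t0 T p q : R) (u v : R -> Omega -> 'cV[R]_m) :
  admissible Pr w t0 T u -> admissible Pr w t0 T v ->
  admissible Pr w t0 T (fun t o => p *: u t o + q *: v t o).
Proof.
move=> [mu_ au /(process_square_integrableP mu_) su].
move=> [mv av /(process_square_integrableP mv) sv].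
have mz i : jointly_measurable t0 T (fun t o => (p *: u t o + q *: v t o) i 0).
  rewrite /jointly_measurable; under [X in measurable_fun _ X]eq_fun do rewrite !mxE.
  exact: (jointly_measurable_lin p q (mu_ i) (mv i)).
split => //.
- move=> t i tT; under [X in measurable_wrt _ X]eq_fun do rewrite !mxE.
  exact: (measurable_wrt_lin p q (smallest_sigma_algebra _ _)
    (au t i tT) (av t i tT)).
- apply/(process_square_integrableP mz).
  by apply: square_integrable_vec_lin => //; exact: measurable_strip.
Qed.

Lemma is_state_terminal n m (S : lq_data R n m) (t0 T : R) x0 u x :
  t0 <= T -> is_state Pr w S t0 T x0 u x ->
  square_integrable_vec Pr [set: Omega] (x T).
Proof.
move=> t0T [mx _ _ xoo _].
have Tin : T \in `[t0, T] by rewrite in_itv/= lexx t0T.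
apply/(square_integrable_vecP Pr measurableT) => [i|]; last exact: xoo.
exact: (measurable_strip_section Tin (mx i)).
Qed.

Hypothesis mw : forall t, 0 <= t -> measurable_fun [set: Omega] (w t).

(** The state equation is linear in initial value, control and state jointly; the stochastic term is
    handled by [is_ito_integral_lin]. *)
Lemma is_state_lin n m (S : lq_data R n m) (t0 T p q : R) x0 y0 u v x y :
  0 <= t0 -> t0 <= T -> lq_standing S T ->
  admissible Pr w t0 T u -> admissible Pr w t0 T v ->
  is_state Pr w S t0 T x0 u x -> is_state Pr w S t0 T y0 v y ->
  is_state Pr w S t0 T (p *: x0 + q *: y0)
    (fun t o => p *: u t o + q *: v t o) (fun t o => p *: x t o + q *: y t o).
Proof.
move=> t00 t0T [[bA bB bAb bBb] _] [mu_ _ /(process_square_integrableP mu_) su].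
move=> [mv _ /(process_square_integrableP mv) sv] hx hy.
have sxT := is_state_terminal t0T hx; have syT := is_state_terminal t0T hy.
case: hx hy => [mx cx /(process_square_integrableP mx) sx xoo Ix].
move=> [my cy /(process_square_integrableP my) sy yoo Iy].
have mz i : jointly_measurable t0 T (fun t o => (p *: x t o + q *: y t o) i 0).
  rewrite /jointly_measurable; under [X in measurable_fun _ X]eq_fun do rewrite !mxE.
  exact: (jointly_measurable_lin p q (mx i) (my i)).
split => //.
- apply: filterS2 cx cy => o cx cy i.
  have -> : (fun t => (p *: x t o + q *: y t o) i 0) =
      (fun t => p * x t o i 0 + q * y t o i 0).
    by apply/funext => t; rewrite !mxE.
  move=> t; apply: cvgD; apply: cvgM; [exact: cvg_cst|exact: cx|
    exact: cvg_cst|exact: cy].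
- apply/(process_square_integrableP mz).
  by apply: square_integrable_vec_lin => //; exact: measurable_strip.
- move=> t tT.
  have mzt i := measurable_strip_section tT (mz i).
  apply/(square_integrable_vecP Pr measurableT) => //.
  apply: square_integrable_vec_lin => //.
  + apply/(square_integrable_vecP Pr measurableT) => [i|]; last exact: xoo.
    exact: (measurable_strip_section tT (mx i)).
  + apply/(square_integrable_vecP Pr measurableT) => [i|]; last exact: yoo.
    exact: (measurable_strip_section tT (my i)).
- move=> t i tT; have [I itoI xI] := Ix t i tT; have [J itoJ yJ] := Iy t i tT.
  have affE (A : 'M[R]_n) (B : 'M[R]_(n, m)) s o :
      (A *m (p *: x s o + q *: y s o) + B *m (p *: u s o + q *: v s o)) i 0 =
      p * (A *m x s o + B *m u s o) i 0 + q * (A *m y s o + B *m v s o) i 0.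
    rewrite !mulmxDr -!scalemxAr; move: (A *m _) (A *m _) (B *m _) (B *m _).
    by move=> c1 c2 c3 c4; rewrite !mxE; ring.
  exists (fun o => p * I o + q * J o).
    rewrite (_ : (fun s o => _) = fun s o =>
        p * (lqAbar S s *m x s o + lqBbar S s *m u s o) i 0 +
        q * (lqAbar S s *m y s o + lqBbar S s *m v s o) i 0); last first.
      by apply/funext => s; apply/funext => o; exact: affE.
    apply: is_ito_integral_lin itoI itoJ.
    + by move=> s; exact: smallest_sigma_algebra.
    + move=> s; apply: brownian_filtration_sub => r t0r; apply: mw.
      exact: le_trans t0r.
    + by move=> s t0s; apply: mw; exact: le_trans t0s.
  (* The drift is square-integrable on a strip of finite measure, hence integrable there, and so are
     almost all of its time sections, first on [[t0, T]] and then on [[t0, t]]. *)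
  have section z r : process_square_integrable t0 T z ->
      process_square_integrable t0 T r -> {ae Pr, forall o,
      mu.-integrable `[t0, t]
       (EFin \o (fun s => (lqA S s *m z s o + lqB S s *m r s o) i 0))}.
    move=> sz sr.
    have /(_ i)/square_integrable_integrable :=
      process_square_integrable_affine t00 bA bB sz sr.
    move=> /(_ (measurable_strip _ _) (strip_lty _ _ _))/ae_integrable_section.
    apply: filterS => o; apply: integrableS => //.
    by apply: subset_itvl; rewrite bnd_simp; move: tT; rewrite in_itv/= => /andP[].
  have xyIJ := ae_conj xI yJ.
  have fg := ae_conj (section _ _ sx su) (section _ _ sy sv).
  apply: filterS2 xyIJ fg => o [xo yo] [f1 g1].
  have linE (c1 c2 : 'cV[R]_n) : (p *: c1 + q *: c2) i 0 = p * c1 i 0 + q * c2 i 0.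
    by rewrite !mxE.
  rewrite !linE xo yo.
  under [X in _ = _ + X + _]eq_Rintegral do rewrite affE.
  by rewrite Rintegral_lin//; ring.
Qed.

(** * The cost as a real number, and its expansion along a segment *)

Definition real_cost n m (S : lq_data R n m) (t0 T : R)
    (u : R -> Omega -> 'cV[R]_m) (x : R -> Omega -> 'cV[R]_n) : R :=
  \int[(mu \x Pr)%E]_(z in strip t0 T)
    (quad (lqQ S z.1) (x z.1 z.2) + quad (lqW S z.1) (u z.1 z.2))
  + \int[Pr]_o quad (lqH S) (x T o).

Section Cost.
Variables (n m : nat) (S : lq_data R n m) (t0 T : R).
Hypotheses (t00 : 0 <= t0) (std : lq_standing S T).
Implicit Types (u v : R -> Omega -> 'cV[R]_m) (x y : R -> Omega -> 'cV[R]_n).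

Let admissible_state u x :=
  [/\ process_square_integrable t0 T u, process_square_integrable t0 T x &
      square_integrable_vec Pr [set: Omega] (x T)].

Lemma integrable_running_cost u x : admissible_state u x ->
  (mu \x Pr)%E.-integrable (strip t0 T) (EFin \o (fun z =>
    quad (lqQ S z.1) (x z.1 z.2) + quad (lqW S z.1) (u z.1 z.2))).
Proof.
move=> [su sx _]; have [_ [bQ bW _ _ _]] := std.
have mD := @measurable_strip R d Omega t0 T.
exact: (integrableD mD
  (integrable_quad mD (bounded_measurable_strip t00 bQ) sx)
  (integrable_quad mD (bounded_measurable_strip t00 bW) su)).
Qed.

(** All integrands are integrable, so Fubini applies and the extended cost is finite. Differences of
    costs can then be formed in [R]. *)
Lemma costE u x : admissible_state u x ->
  cost Pr S t0 T u x = (real_cost S t0 T u x)%:E.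
Proof.
move=> ux; have [_ _ xT] := ux; rewrite /cost EFinD; congr (_ + _)%E.
  rewrite (iterated_integral (integrable_running_cost ux)).
  apply: integrable_EFinE; first exact: measurable_strip.
  exact: integrable_running_cost.
by rewrite integrable_EFinE//; exact: integrable_quad_cst.
Qed.

(** This is [quad_segment] integrated: the coefficient of [e ^+ 2] is the cost of the difference
    process, and the linear coefficient is fixed by the value at [e = 1]. *)
Lemma real_cost_segment u v x y (e : R) :
  let du t o := (-1) *: u t o + 1 *: v t o in
  let dx t o := (-1) *: x t o + 1 *: y t o in
  admissible_state u x -> admissible_state v y -> admissible_state du dx ->
  real_cost S t0 T (fun t o => (1 - e) *: u t o + e *: v t o)
    (fun t o => (1 - e) *: x t o + e *: y t o) =
  real_cost S t0 T u x
  + e * (real_cost S t0 T v y - real_cost S t0 T u x - real_cost S t0 T du dx)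
  + e ^+ 2 * real_cost S t0 T du dx.
Proof.
move=> du dx ux vy dd; rewrite /real_cost.
under eq_Rintegral do rewrite !quad_segment.
under [X in _ + X = _]eq_Rintegral do rewrite quad_segment.
have [[_ _ xT] [_ _ yT] [_ _ dT]] := And3 ux vy dd.
rewrite (Rintegral_segment measurableT e (integrable_quad_cst measurableT _ xT)
  (integrable_quad_cst measurableT _ yT) (integrable_quad_cst measurableT _ dT)).
transitivity (\int[(mu \x Pr)%E]_(z in strip t0 T)
  ((quad (lqQ S z.1) (x z.1 z.2) + quad (lqW S z.1) (u z.1 z.2))
   + e * ((quad (lqQ S z.1) (y z.1 z.2) + quad (lqW S z.1) (v z.1 z.2))
     - (quad (lqQ S z.1) (x z.1 z.2) + quad (lqW S z.1) (u z.1 z.2))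
     - (quad (lqQ S z.1) (dx z.1 z.2) + quad (lqW S z.1) (du z.1 z.2)))
   + e ^+ 2 * (quad (lqQ S z.1) (dx z.1 z.2) + quad (lqW S z.1) (du z.1 z.2)))
  + (\int[Pr]_o quad (lqH S) (x T o)
   + e * (\int[Pr]_o quad (lqH S) (y T o) - \int[Pr]_o quad (lqH S) (x T o)
     - \int[Pr]_o quad (lqH S) (dx T o))
   + e ^+ 2 * \int[Pr]_o quad (lqH S) (dx T o))).
  by congr (_ + _); apply: eq_Rintegral => z _; rewrite /du /dx; ring.
rewrite (Rintegral_segment (@measurable_strip _ _ _ _ _) e
  (integrable_running_cost ux) (integrable_running_cost vy)
  (integrable_running_cost dd)).
by ring.
Qed.

End Cost.

End ControlledStates.

(** * First-order condition at the minimizer, and the theorem *)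

Lemma stationary_at0 (R : realFieldType) (b c : R) :
  (forall e, 0 <= e * b + e ^+ 2 * c) -> b = 0.
Proof.
move=> h; apply/eqP; apply/negPn/negP => b0.
have s0 : 0 < `|c| + 1 by rewrite ltr_wpDl.
(* The denominator is positive and exceeds [c], so for nonzero [b] the polynomial is negative at
   this point. *)
have := h (- b / (`|c| + 1)).
rewrite (_ : _ + _ = b ^+ 2 * (c - (`|c| + 1)) / (`|c| + 1) ^+ 2); last first.
  by field; exact: lt0r_neq0.
rewrite leNgt => /negP; apply; rewrite pmulr_llt0 ?invr_gt0 ?exprn_gt0//.
rewrite pmulr_rlt0; last by rewrite exprn_even_gt0.
by have := ler_norm c; lra.
Qed.

(** The identity [quad_ker] holds at almost every point, which suffices under the integral. *)
Lemma Rintegral_quad_ker {d} {X : measurableType d} {R : realType}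
    (nu : {measure set X -> \bar R}) n (K : 'M[R]_n) (f g : X -> 'cV[R]_n) (e : R) :
  K^T = K -> square_integrable_vec nu [set: X] f ->
  square_integrable_vec nu [set: X] g -> {ae nu, forall x, K *m f x = 0} ->
  \int[nu]_x quad K ((1 - e) *: f x + e *: g x) = e ^+ 2 * \int[nu]_x quad K (g x).
Proof.
move=> sK sf sg Kf.
have intK h := @integrable_quad_cst _ _ _ nu _ measurableT _ K h.
rewrite -RintegralZl//; last exact: intK.
congr fine; apply: ae_eq_integral => //.
- by apply: (measurable_int nu); apply: intK; exact: square_integrable_vec_lin.
- by apply: (measurable_int nu); exact: (integrableZl measurableT _ (intK _ sg)).
- by apply: filterS Kf => x Kfx _; rewrite quad_ker.
Qed.

Theorem theorem2 (R : realType) (d : measure_display)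
  (Omega : measurableType d) (Pr : probability Omega R) (w : R -> Omega -> R)
  (n m m0 : nat) (S : lq_data R n m) (T : R)
  (P P1 : R -> 'M[R]_n) (P1T : 'M[R]_n) (T0 : R -> 'M[R]_m)
  (Ups0 := fun t => lqUpsilon S t (P t))
  (Z := fun t => 1%:M - P1 t *m Fbar0 S P t)
  (Bb0 := fun t => Bbar0 m0 S t (P t) (T0 t)) :
  0 < T ->
  brownian_motion Pr w ->
  lq_standing S T ->
  lq_convex Pr w S T ->
  P1T^T = P1T ->
  riccati_solution S T P ->
  (m0 < m)%N ->
  (forall t, t \in `[0, T] -> \rank (Ups0 t) = m0) ->
  (forall t, t \in `[0, T] -> row_reduces m0 S t (P t) (T0 t)) ->
  riccati1_solution S P T P1T P1 ->
  (forall t, t \in `[0, T] ->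
     [/\ (lqB S t)^T = (lqB S t)^T *m mpinv (Z t) *m Z t,
         (lqAbar S t)^T = (lqAbar S t)^T *m mpinv (Z t) *m Z t &
         (lqBbar S t)^T = (lqBbar S t)^T *m mpinv (Z t) *m Z t]) ->
  (forall t, t \in `[0, T] ->
     forall L : 'M[R]_(n, m), L = lqB S t \/ L = lqBbar S t ->
       mpinv (Ups0 t + (lqBbar S t)^T *m P1 t *m lqBbar S t) *m L^T =
       (1%:M - mpinv (Ups0 t) *m (lqBbar S t)^T *m mpinv (Z t) *m P1 t
                 *m lqBbar S t) *m mpinv (Ups0 t) *m L^T) ->
  (forall t, t \in `[0, T] ->
     0 = (Bb0 t)^T *m mpinv (Z t) *m P1 t *m Bb0 t) ->
  regular (add_terminal S P1T) T ->
  terminal_constraint_achieved Pr w S T P1T ->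
  lq_solvable Pr w S T.

Proof.
move=> _ [mw _ _ _ _] std convex sK _ _ _ _ _ _ _ _ _ achieved t0 x0 t00 t0T.
have [u [x [[au hx umin] KxT]]] := achieved t0 x0 t00 t0T.
exists u, x; split => // v y av hy.
pose du t o := (-1) *: u t o + 1 *: v t o.
pose dx t o := (-1) *: x t o + 1 *: y t o.
have adu : admissible Pr w t0 T du by exact: admissible_lin.
(* The two initial values cancel, so the convexity assumption applies to the difference. *)
have hdx : is_state Pr w S t0 T 0 du dx.
  have := is_state_lin mw (-1) 1 t00 (ltW t0T) std au av hx hy.
  by rewrite scaleN1r scale1r addNr.
have square_integrable_state z0 r z :
    admissible Pr w t0 T r -> is_state Pr w S t0 T z0 r z ->
    [/\ process_square_integrable Pr t0 T r, process_square_integrable Pr t0 T z &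
        square_integrable_vec Pr [set: Omega] (z T)].
  move=> [mr _ rL2] hz; have zT := is_state_terminal (ltW t0T) hz.
  by case: hz => mz _ zL2 _ _; split => //; exact/process_square_integrableP.
have ux := square_integrable_state _ _ _ au hx.
have vy := square_integrable_state _ _ _ av hy.
have dd := square_integrable_state _ _ _ adu hdx.
have := convex t0 t00 t0T du dx adu hdx.
rewrite !(costE t00 std)// !lee_fin => d_ge0.
set cu := real_cost _ _ _ _ u x; set cv := real_cost _ _ _ _ v y.
set cd := real_cost _ _ _ _ du dx in d_ge0 *.
(* [cv - cu - cd] is the linear coefficient of the cost along the segment; once it is zero,
   [cv - cu] equals [cd], which is nonnegative. *)
suff b0 : cv - cu - cd = 0 by lra.
(* The quadratic coefficient of the changed cost: that of the original cost plus that of the added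
   terminal term. *)
apply: (@stationary_at0 _ _ (cd + \int[Pr]_o quad P1T (y T o))) => e.
pose ue t o := (1 - e) *: u t o + e *: v t o.
pose xe t o := (1 - e) *: x t o + e *: y t o.
have aue : admissible Pr w t0 T ue by exact: admissible_lin.
(* The weights sum to 1, so the segment starts at [x0] and its points compete with [u] for every
   real [e]. *)
have hxe : is_state Pr w S t0 T x0 ue xe.
  have := is_state_lin mw (1 - e) e t00 (ltW t0T) std au av hx hy.
  by rewrite -scalerDl subrK scale1r.
have uxe := square_integrable_state _ _ _ aue hxe.
have := umin ue xe aue hxe; rewrite /changed_cost !(costE t00 std)//.
have [[_ _ xT] [_ _ yT] [_ _ xeT]] := And3 ux vy uxe.
rewrite !(integrable_EFinE measurableT)//; try exact: integrable_quad_cst.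
have terminal c : \int[Pr]_o quad P1T ((1 - c) *: x T o + c *: y T o) =
    c ^+ 2 * \int[Pr]_o quad P1T (y T o) by exact: Rintegral_quad_ker.
(* At [c = 0] this says that the added terminal cost of [x] itself vanishes. *)
have := terminal 0; under eq_Rintegral do rewrite subr0 scale1r scale0r addr0.
move=> ->; rewrite terminal expr0n mul0r addr0.
rewrite -EFinD lee_fin (real_cost_segment t00 std)//.
rewrite -/du -/dx -/cu -/cv -/cd; lra.
Qed.
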